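(* Let $K$ be a real field (i.e., a field in which $-1$ is not a sum of squares). The diagram of $K$ in the language $\mathcal L_{of}$ of ordered fields does not collapse in the theory of ordered fields.
   Context: Language of ordered fields $\mathcal L_{of}$: constants $0,1,-1$, operations $+,\times$, and three unary relation symbols ''$=0$'', ''$\ge0$'', ''$>0$''. Terms over a set of variables $G$ are identified with polynomials in $\mathbb Z[G]$. A presentation $(G;R_{=0},R_{\ge0},R_{>0})$ is a set $G$ of variables (generators) and three subsets of $\mathbb Z[G]$, with relations $p=0$, $p\ge0$, $p>0$ for $p$ in $R_{=0}$, $R_{\ge0}$, $R_{>0}$ respectively. The diagram of the field $K$ (which is not given with an order) is the presentation with one generator $X_a$ for each $a\in K$ and with relations $P(X_{a_1},\dots,X_{a_r})=0$ for all integer polynomials $P$ and $a_1,\dots,a_r\in K$ with $P(a_1,\dots,a_r)=0$ in $K$. Theory of ordered fields: $\vdash 0=0$; $x=0,y=0\vdash x+y=0$; $x=0\vdash xy=0$; $\vdash x^2\ge0$; $x=0,y\ge0\vdash x+y\ge0$; $x\ge0,y\ge0\vdash x+y\ge0$; $x\ge0,y\ge0\vdash xy\ge0$; $\vdash1>0$; $x=0,y>0\vdash x+y>0$; $x>0,y\ge0\vdash x+y>0$; $x>0,y>0\vdash xy>0$; $x>0\vdash x\ge0$; $0>0\vdash\bot$; $x\ge0,-x\ge0\vdash x=0$; $xy-1=0\vdash x^2>0$; $x\ge0,x^2>0\vdash x>0$; $x^2>0\vdash\exists y\ xy-1=0$; $\vdash x\ge0\vee -x\ge0$; $\vdash x=0\vee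 x^2>0$. Covering: a covering of a presentation $(G;R)$ in a theory given by such axioms (each of the form $H(\mathbf x)\vdash\exists\mathbf y_1A_1(\mathbf x,\mathbf y_1)\vee\cdots\vee\exists\mathbf y_kA_k(\mathbf x,\mathbf y_k)$ with $H,A_i$ conjunctions of atomic formulas, $k\ge0$, the case $k=0$ being written $\bot$) is a finite tree whose nodes $n$ carry presentations $(G_n;R_n)$. At the root one has $(G;R)$ plus finitely many consequences of $R$ under the algebraic axioms (those with a single atomic formula and no $\exists$ on the right). At a node $n$, if $\mathbf t$ is a list of terms over $G_n$ and all conjuncts of $H(\mathbf t)$ are in $R_n$, one may create $k$ children, the $i$-th with generators $G_n\cup\{\mathbf z_i\}$ ($\mathbf z_i$ new variables) and relations $R_n\cup\{A_i(\mathbf t,\mathbf z_i)\}$ plus finitely many consequences under algebraic axioms. A branch ended by an application of an axiom with $k=0$ is dead. $(G;R)$ collapses if it has a covering all of whose branches are dead. *)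

(* Defs.v *)
From Stdlib Require List.
From HB Require Import structures.
From mathcomp Require Import all_boot all_order all_algebra.
From mathcomp Require Import finmap.
From mathcomp.multinomials Require Import monalg.

Set Implicit Arguments.
Unset Strict Implicit.
Unset Printing Implicit Defensive.

Import GRing.Theory.
Local Open Scope ring_scope.

(* Z[G]: the algebra over the integers of the free commutative monoid on the
   (possibly infinite) set of variables G. *)
Notation zpoly G := {malg int[cmonom G]}.

HB.lock Definition zvar (G : choiceType) (g : G) : zpoly G := << ucm g >>.

(* The value of a polynomial in a ring S under the assignment v; with
   S := zpoly G' this is the substitution of terms for the variables.  The locks
   on zvar and zeval keep a failing comparison of two polynomials from
   computing in the monoid algebra. *)
HB.lock Definition zeval (G : choiceType) (S : comNzRingType) (v : G -> S)
    (p : zpoly G) : S :=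
  mmap (fun c : int => c%:~R)
       (fun m : {cmonom G} => \prod_(g <- finsupp m) v g ^+ m g) p.

Inductive atom (G : choiceType) : Type :=
  | Eq0 of zpoly G
  | Ge0 of zpoly G
  | Gt0 of zpoly G.

Definition asubst (G G' : choiceType) (t : G -> zpoly G') (A : atom G) :
    atom G' :=
  match A with
  | Eq0 p => Eq0 (zeval t p)
  | Ge0 p => Ge0 (zeval t p)
  | Gt0 p => Gt0 (zeval t p)
  end.

Definition arename (G G' : choiceType) (f : G -> G') : atom G -> atom G' :=
  asubst (fun g => zvar (f g)).

(* The generators of a presentation are all the elements of G; its three sets
   of relations are gathered in one set of atoms. *)
Definition presentation (G : choiceType) := atom G -> Prop.

Definition add_atoms (G : choiceType) (R : presentation G)
    (l : seq (atom G)) : presentation G :=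
  fun A => R A \/ List.In A l.

(* exists y_0 ... y_(m-1), /\ conjuncts, where the free variables x_0 ... x_(n-1)
   are the inl i and the bound variables y_j are the inr j. *)
Record disjunct (n : nat) := Disjunct {
  nbound : nat;
  conjuncts : seq (atom ('I_n + 'I_nbound)%type)
}.

(* ax_hyps |- \/ ax_concls; the empty disjunction is falsity. *)
Record axiom := Sequent {
  nfree : nat;
  ax_hyps : seq (atom 'I_nfree);
  ax_concls : seq (disjunct nfree)
}.

Definition theory := axiom -> Prop.

Definition atomic_disjunct (n : nat) (A : atom 'I_n) : disjunct n :=
  Disjunct [:: arename (fun i => (inl i : 'I_n + 'I_0)%type) A].

(* Algebraic axioms are those of this form. *)
Definition algebraic (n : nat) (H : seq (atom 'I_n)) (A : atom 'I_n) : axiom :=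
  Sequent H [:: atomic_disjunct A].

Inductive consequence (T : theory) (G : choiceType) (R : presentation G) :
    atom G -> Prop :=
  | ConseqRel A of R A : consequence T R A
  | ConseqAx n (H : seq (atom 'I_n)) (A : atom 'I_n) (t : 'I_n -> zpoly G) of
      T (algebraic H A) &
      (forall B, List.In B H -> consequence T R (asubst t B)) :
      consequence T R (asubst t A).

(* The substitution of (t, z) for the variables (x, y) of a disjunct, over the
   generators G enlarged by the new variables z. *)
Definition child_subst (n m : nat) (G : choiceType) (t : 'I_n -> zpoly G)
    (v : 'I_n + 'I_m) : zpoly (G + 'I_m)%type :=
  match v with
  | inl i => zeval (fun g => zvar (inl g : G + 'I_m)%type) (t i)
  | inr j => zvar (inr j : G + 'I_m)%type
  end.

Inductive child (n : nat) (D : disjunct n) (G : choiceType)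
    (R : presentation G) (t : 'I_n -> zpoly G) :
    presentation (G + 'I_(nbound D))%type :=
  | ChildOld A of R A :
      child R t (arename (fun g => (inl g : G + 'I_(nbound D))%type) A)
  | ChildNew A of List.In A (conjuncts D) : child R t (asubst (child_subst t) A).

(* In both constructors l is the list of the consequences added at the node, so
   that the node carries add_atoms R l.  CovLeaf ends a branch without killing
   it. *)
Inductive covering (T : theory) (G : choiceType) (R : presentation G) : Type :=
  | CovLeaf (l : seq (atom G)) of
      (forall A, List.In A l -> consequence T R A)
  | CovNode (l : seq (atom G)) (a : axiom) (t : 'I_(nfree a) -> zpoly G) of
      (forall A, List.In A l -> consequence T R A) &
      T a &
      (forall A, List.In A (ax_hyps a) -> add_atoms R l (asubst t A)) &
      (forall i : 'I_(size (ax_concls a)),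
         covering T (@child _ (tnth (in_tuple (ax_concls a)) i) G
                            (add_atoms R l) t)).

(* A node created with an axiom whose conclusion is falsity has no child: its
   branch is dead. *)
Fixpoint all_dead (T : theory) (G : choiceType) (R : presentation G)
    (c : covering T R) : Prop :=
  match c with
  | CovLeaf _ _ => False
  | CovNode _ _ _ _ _ _ ch => forall i, all_dead (ch i)
  end.

Definition collapses (T : theory) (G : choiceType) (R : presentation G) : Prop :=
  exists c : covering T R, all_dead c.

Local Notation x := (zvar ord0).
Local Notation y := (zvar (@Ordinal 2 1 isT)).
Local Notation free_x := (zvar (inl ord0 : 'I_1 + 'I_1)%type).
Local Notation bound_y := (zvar (inr ord0 : 'I_1 + 'I_1)%type).

Definition ordered_field_axioms : seq axiom := [::
  @algebraic 0 [::] (Eq0 0);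
  @algebraic 2 [:: Eq0 x; Eq0 y] (Eq0 (x + y));
  @algebraic 2 [:: Eq0 x] (Eq0 (x * y));
  @algebraic 1 [::] (Ge0 (x ^+ 2));
  @algebraic 2 [:: Eq0 x; Ge0 y] (Ge0 (x + y));
  @algebraic 2 [:: Ge0 x; Ge0 y] (Ge0 (x + y));
  @algebraic 2 [:: Ge0 x; Ge0 y] (Ge0 (x * y));
  @algebraic 0 [::] (Gt0 1);
  @algebraic 2 [:: Eq0 x; Gt0 y] (Gt0 (x + y));
  @algebraic 2 [:: Gt0 x; Ge0 y] (Gt0 (x + y));
  @algebraic 2 [:: Gt0 x; Gt0 y] (Gt0 (x * y));
  @algebraic 1 [:: Gt0 x] (Ge0 x);
  @Sequent 0 [:: Gt0 0] [::];
  @algebraic 1 [:: Ge0 x; Ge0 (- x)] (Eq0 x);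
  @algebraic 2 [:: Eq0 (x * y - 1)] (Gt0 (x ^+ 2));
  @algebraic 1 [:: Ge0 x; Gt0 (x ^+ 2)] (Gt0 x);
  @Sequent 1 [:: Gt0 (x ^+ 2)]
               [:: @Disjunct 1 1 [:: Eq0 (free_x * bound_y - 1)]];
  @Sequent 1 [::] [:: @atomic_disjunct 1 (Ge0 x);
                      @atomic_disjunct 1 (Ge0 (- x))];
  @Sequent 1 [::] [:: @atomic_disjunct 1 (Eq0 x);
                      @atomic_disjunct 1 (Gt0 (x ^+ 2))]
].

Definition ordered_field_theory : theory :=
  fun a => List.In a ordered_field_axioms.

Inductive diagram (K : fieldType) : presentation K :=
  | DiagramRel (r : nat) (P : zpoly 'I_r) (a : 'I_r -> K) of zeval a P = 0 :
      diagram (Eq0 (zeval (fun i => zvar (a i)) P)).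

Definition real_field (K : fieldType) : Prop :=
  ~ exists s : seq K, -1 = \sum_(b <- s) b ^+ 2.

(* Main.v *)
Require Import Defs.
From HB Require Import structures.
From mathcomp Require Import all_boot all_order all_algebra.
From mathcomp Require Import ring.
From mathcomp Require Import finmap.
From mathcomp.multinomials Require Import monalg.

(** The theorem is a soundness statement.  Call preordering of K a set of
    elements that is closed under sums and products, contains the squares and
    does not contain -1.  The sums of squares form one, because K is real.

    Fix a preordering T and read p >= 0 as membership of the value of p in T,
    and p > 0 as membership of this value in T without 0.  All the axioms but
    one then hold in K ([ordered_field_sound]): what they require of T beyond
    its closure properties is that it meets -T in 0 only, and indeed x and -x in
    T with x nonzero would give -1 = x * -x * (1/x)^2 in T
    ([preordering_antisym]).  The exception is the axiom saying that x >= 0 or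
    -x >= 0; it may fail in T, but it holds in a larger preordering, since
    T + Tx and T - Tx cannot both contain -1 ([adjoin_proper]).  As T only
    grows, the relations that were true remain so.

    Going down a covering from its root, one can thus enlarge T and choose a
    child at each node in such a way that all the relations of the child are
    true in K for some values of its generators.  The branch followed is not
    dead, because 0 > 0 is false whatever the preordering.  Formally this is an
    induction on the covering ([no_dead_covering]), started with the sums of
    squares and the identity valuation of the diagram.  A covering being finite,
    the finitely many extensions met on a branch do the work of a total order on
    K, and Zorn's lemma is avoided; so is the excluded middle, since the
    existence of a good child is only used to reach a contradiction. *)

Set Implicit Arguments.
Unset Strict Implicit.
Unset Printing Implicit Defensive.

Import GRing.Theory.
Local Open Scope ring_scope.

(** * Evaluation of polynomials *)

Section Evaluation.

Variables (G : choiceType) (S : comNzRingType).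
Implicit Types (v : G -> S) (p : zpoly G).

Definition monomial_value v (m : cmonom G) : S :=
  \prod_(g <- finsupp m) v g ^+ m g.

Lemma monomial_value_widen v (m : cmonom G) (d : {fset G}) :
  (finsupp m `<=` d)%fset ->
  monomial_value v m = \prod_(g <- d) v g ^+ m g.
Proof.
move=> le; rewrite /monomial_value.
by apply: big_fset_incl le _ => g _; rewrite -cmE_eq0 => /eqP ->; rewrite expr0.
Qed.

Lemma monomial_value_morphism v : mmorphism (monomial_value v).
Proof.
split=> [m1 m2|]; last by rewrite /monomial_value mdom1 big_seq_fset0.
have le1 : (finsupp m1 `<=` finsupp (mmul m1 m2))%fset.
  by rewrite mdomD fsubsetUl.
have le2 : (finsupp m2 `<=` finsupp (mmul m1 m2))%fset.
  by rewrite mdomD fsubsetUr.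
rewrite (monomial_value_widen v le1) (monomial_value_widen v le2) -big_split /=.
by apply: eq_bigr => g _; rewrite cmM exprD.
Qed.

HB.instance Definition _ v :=
  isMultiplicative.Build (cmonom G) S (monomial_value v)
    (monomial_value_morphism v).

Lemma zevalE v : zeval v =1 mmap intr (monomial_value v).
Proof. by move=> p; rewrite zeval.unlock. Qed.

Lemma zeval_additive v : zmod_morphism (zeval v).
Proof. by move=> p q; rewrite !zevalE raddfB. Qed.

Lemma zeval_multiplicative v : monoid_morphism (zeval v).
Proof. by split=> [|p q]; rewrite !zevalE ?rmorphM ?rmorph1. Qed.

HB.instance Definition _ v :=
  GRing.isZmodMorphism.Build (zpoly G) S (zeval v) (zeval_additive v).
HB.instance Definition _ v :=
  GRing.isMonoidMorphism.Build (zpoly G) S (zeval v) (zeval_multiplicative v).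

Lemma zeval_var v g : zeval v (zvar g) = v g.
Proof.
rewrite zevalE zvar.unlock mmapU /= mul1r /monomial_value mdomU big_seq_fset1.
by rewrite cmUU.
Qed.

Lemma zeval0 v : zeval v 0 = 0. Proof. exact: rmorph0. Qed.
Lemma zeval1 v : zeval v 1 = 1. Proof. exact: rmorph1. Qed.
Lemma zevalN v : {morph zeval v : p / - p}. Proof. exact: rmorphN. Qed.
Lemma zevalD v : {morph zeval v : p q / p + q}. Proof. exact: rmorphD. Qed.
Lemma zevalM v : {morph zeval v : p q / p * q}. Proof. exact: rmorphM. Qed.
Lemma zevalX v n : {morph zeval v : p / p ^+ n}. Proof. exact: rmorphXn. Qed.

(** The six rules above specialise those of all morphisms, whose use would leave
    behind a bundled morphism on which [zeval_var] does not rewrite. *)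
Definition evalE :=
  (zeval_var, zeval0, zeval1, zevalN, zevalD, zevalM, zevalX).

Lemma eq_zeval v w : v =1 w -> zeval v =1 zeval w.
Proof.
move=> eq_vw p; rewrite !zevalE; apply: eq_bigr => m _; congr (_ * _).
by apply: eq_bigr => g _; rewrite eq_vw.
Qed.

End Evaluation.

Lemma zeval_comp (G G' : choiceType) (S : comNzRingType) (t : G -> zpoly G')
    (v : G' -> S) p :
  zeval v (zeval t p) = zeval (fun g => zeval v (t g)) p.
Proof.
rewrite [zeval t p]zevalE [RHS]zevalE /mmap rmorph_sum; apply: eq_bigr => m _.
rewrite rmorphM rmorph_int rmorph_prod; congr (_ * _).
by apply: eq_bigr => g _; rewrite rmorphXn.
Qed.

(** * Preorderings of a field *)

Section Preordering.

Variable K : fieldType.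

Record preordering (T : K -> Prop) : Prop := Preordering {
  preordering_sqr x : T (x ^+ 2);
  preorderingD x y : T x -> T y -> T (x + y);
  preorderingM x y : T x -> T y -> T (x * y);
  preordering_proper : ~ T (-1)
}.

Definition sum_of_squares (x : K) := exists s : seq K, x = \sum_(b <- s) b ^+ 2.

Lemma sum_of_squares_preordering : real_field K -> preordering sum_of_squares.
Proof.
move=> realK; split=> [x|_ _ [s ->] [t ->]|_ _ [s ->] [t ->]|//].
- by exists [:: x]; rewrite big_seq1.
- by exists (s ++ t); rewrite big_cat.
- exists [seq b * c | b <- s, c <- t]; rewrite big_allpairs_dep mulr_suml.
  apply: eq_bigr => b _; rewrite mulr_sumr.
  by apply: eq_bigr => c _; rewrite exprMn.
Qed.

Section Theory.

Variables (T : K -> Prop) (preT : preordering T).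

Lemma preordering0 : T 0.
Proof. by have := preordering_sqr preT 0; rewrite expr0n. Qed.

Lemma preordering1 : T 1.
Proof. by have := preordering_sqr preT 1; rewrite expr1n. Qed.

(** Division by x is essential here: in a ring, a preordering may contain
    nonzero x and -x without containing -1. *)
Lemma preordering_antisym x : T x -> T (- x) -> x = 0.
Proof.
move=> Tx TNx; apply/eqP/negPn/negP => x_neq0; apply: (preordering_proper preT).
have -> : -1 = x * - x * x^-1 ^+ 2 by field.
apply: (preorderingM preT); last exact: (preordering_sqr preT).
exact: (preorderingM preT).
Qed.

Lemma preordering_add_neq0 x y : T x -> x != 0 -> T y -> x + y != 0.
Proof.
move=> Tx x_neq0 Ty; apply: contra x_neq0; rewrite addr_eq0 => /eqP xE.
by apply/eqP/preordering_antisym; rewrite // xE opprK.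
Qed.

(** The closure of T and x under sums and products: it is made of elements that
    are linear in x because x^2 is already in T. *)
Definition adjoin (x y : K) := exists a b, [/\ T a, T b & y = a + b * x].

Lemma adjoin_sub x y : T y -> adjoin x y.
Proof.
by exists y, 0; rewrite mul0r addr0; split=> //; apply: preordering0.
Qed.

Lemma adjoin_gen x : adjoin x x.
Proof.
exists 0, 1; rewrite mul1r add0r.
by split=> //; [apply: preordering0 | apply: preordering1].
Qed.

Lemma adjoin_preordering x : ~ adjoin x (-1) -> preordering (adjoin x).
Proof.
move=> propx; have [sqrT addT mulT _] := preT.
split=> // [y|_ _ [a [b [Ta Tb ->]]] [c [d [Tc Td ->]]]
             |_ _ [a [b [Ta Tb ->]]] [c [d [Tc Td ->]]]].
- exact: adjoin_sub.
- by exists (a + c), (b + d); split; [exact: addT|exact: addT|ring].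
- exists (a * c + b * d * x ^+ 2), (a * d + b * c).
  split; last ring.
  + by apply: (addT); apply: (mulT) => //; apply: (mulT).
  + by apply: (addT); apply: (mulT).
Qed.

(** From -1 = a + bx and -1 = c - dx one gets (1 + a)(1 + c) = - bd x^2, which
    expresses -1 by elements of T alone, so that -1 would be in T. *)
Lemma adjoin_proper x : adjoin x (-1) -> ~ adjoin (- x) (-1).
Proof.
move=> [a [b [Ta Tb eqx]]] [c [d [Tc Td eqNx]]].
have [sqrT addT mulT propT] := preT; apply: propT.
have -> : -1 = a + c + a * c + b * d * x ^+ 2.
  have bxE : b * x = -1 - a by rewrite eqx; ring.
  have dxE : d * x = c - -1 by rewrite eqNx; ring.
  have -> : b * d * x ^+ 2 = (b * x) * (d * x) by ring.
  by rewrite bxE dxE; ring.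
apply: (addT); last by apply: (mulT) => //; apply: (mulT).
by apply: (addT); [apply: (addT) | apply: (mulT)].
Qed.

End Theory.
End Preordering.

(** * Truth of relations in a preordered field *)

Section Truth.

Variable K : fieldType.
Implicit Types T : K -> Prop.

Definition holds (G : choiceType) T (v : G -> K) (A : atom G) : Prop :=
  match A with
  | Eq0 p => zeval v p = 0
  | Ge0 p => T (zeval v p)
  | Gt0 p => T (zeval v p) /\ zeval v p != 0
  end.

Lemma holds_subst (G G' : choiceType) T (t : G -> zpoly G') (v : G' -> K)
    (w : G -> K) A :
  (forall g, zeval v (t g) = w g) ->
  holds T v (asubst t A) <-> holds T w A.
Proof. by move=> vtw; case: A => p /=; rewrite zeval_comp (eq_zeval vtw). Qed.

Lemma holds_mono (G : choiceType) T T' (v : G -> K) A :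
  (forall x, T x -> T' x) -> holds T v A -> holds T' v A.
Proof. by move=> TT'; case: A => p //= => [/TT'|[/TT' ? ?]]. Qed.

Definition join_val (X Y : Type) (v : X -> K) (z : Y -> K) (u : X + Y) : K :=
  match u with inl x => v x | inr y => z y end.

Definition realises n T (w : 'I_n -> K) (D : disjunct n) : Prop :=
  exists z : 'I_(nbound D) -> K,
    forall A, List.In A (conjuncts D) -> holds T (join_val w z) A.

Lemma realises_atomic n T (w : 'I_n -> K) A :
  realises T w (atomic_disjunct A) <-> holds T w A.
Proof.
have renK z : holds T (join_val w z) (arename inl A) <-> holds T w A.
  by apply: holds_subst => i; rewrite zeval_var.
split=> [[z holdsA]|holdsA]; first by apply/renK/holdsA; left.
by exists (fun=> 0) => _ [<-|//]; apply/renK.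
Qed.

(** Soundness in this sense is weaker than truth for T: an axiom with several
    disjuncts only has to be satisfied after an extension of the preordering,
    and in the sense that not every choice of a disjunct fails.  With no
    disjunct this says that the hypotheses are contradictory.  An axiom with a
    single disjunct is satisfied by T itself; this makes the consequences added
    at a node true for the preordering at hand. *)
Definition sound (a : axiom) : Prop :=
  forall T (w : 'I_(nfree a) -> K),
    preordering T -> (forall B, List.In B (ax_hyps a) -> holds T w B) ->
  if ax_concls a is [:: D] then realises T w D
  else ~ forall T' D, preordering T' -> (forall x, T x -> T' x) ->
         List.In D (ax_concls a) -> ~ realises T' w D.

Lemma sound_algebraic n (H : seq (atom 'I_n)) A :
  (forall T (w : 'I_n -> K), preordering T ->
     (forall B, List.In B H -> holds T w B) -> holds T w A) ->
  sound (algebraic H A).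
Proof. by move=> HA T w preT holdsH; apply/realises_atomic/HA. Qed.

Lemma sound_algebraic1 n (B A : atom 'I_n) :
  (forall T (w : 'I_n -> K), preordering T -> holds T w B -> holds T w A) ->
  sound (algebraic [:: B] A).
Proof.
move=> BA; apply: sound_algebraic => T w preT holdsB.
by apply: BA => //; apply: holdsB; left.
Qed.

Lemma sound_algebraic2 n (B C A : atom 'I_n) :
  (forall T (w : 'I_n -> K), preordering T ->
     holds T w B -> holds T w C -> holds T w A) ->
  sound (algebraic [:: B; C] A).
Proof.
move=> BCA; apply: sound_algebraic => T w preT holdsBC.
by apply: BCA => //; apply: holdsBC; [left | right; left].
Qed.

(** Common form of both cases of soundness, as used at an inner node, where the
    number of children does not matter. *)
Lemma sound_refine a T (w : 'I_(nfree a) -> K) :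
  sound a -> preordering T ->
  (forall B, List.In B (ax_hyps a) -> holds T w B) ->
  ~ forall T' D, preordering T' -> (forall x, T x -> T' x) ->
      List.In D (ax_concls a) -> ~ realises T' w D.
Proof.
move=> sound_a preT /(sound_a T w preT).
case: (ax_concls a) => [|D [|D' Ds]] // realD noD.
by apply: (noD T D) => //; left.
Qed.

End Truth.

(** * Soundness of the axioms of ordered fields *)

(** Only the last two axioms branch.  For totality the extension is by x or by
    -x, while for x = 0 or x^2 > 0 the equality test of K decides and T itself
    will do.  The others follow from the closure properties of T, from
    antisymmetry and from the inverses of K. *)
Lemma ordered_field_sound (K : fieldType) a :
  ordered_field_theory a -> sound K a.
Proof.
rewrite /ordered_field_theory /ordered_field_axioms /=.
do ![case=> [<- | ] | by []].
- by apply: sound_algebraic => T w preT _; rewrite /= rmorph0.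
- apply: sound_algebraic2 => T w preT /=.
  by rewrite !evalE => -> ->; rewrite addr0.
- apply: sound_algebraic1 => T w preT /=.
  by rewrite !evalE => ->; rewrite mul0r.
- apply: sound_algebraic => T w preT _ /=.
  by rewrite !evalE; apply: preordering_sqr.
- apply: sound_algebraic2 => T w preT /=.
  by rewrite !evalE => -> Ty; rewrite add0r.
- apply: sound_algebraic2 => T w preT /=.
  by rewrite !evalE; apply: preorderingD.
- apply: sound_algebraic2 => T w preT /=.
  by rewrite !evalE; apply: preorderingM.
- apply: sound_algebraic => T w preT _ /=.
  by rewrite !evalE oner_eq0; split=> //; apply: preordering1.
- apply: sound_algebraic2 => T w preT /=.
  by rewrite !evalE => ->; rewrite add0r.
- apply: sound_algebraic2 => T w preT /=.
  rewrite !evalE => -[Tx x_neq0] Ty.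
  by split; [apply: preorderingD | apply: preordering_add_neq0 Ty].
- apply: sound_algebraic2 => T w preT /=.
  rewrite !evalE => -[Tx x_neq0] [Ty y_neq0].
  by rewrite mulf_neq0 //; split=> //; apply: preorderingM.
- by apply: sound_algebraic1 => T w preT [].
- move=> T w preT hyps _; have [_ /=] := hyps _ (or_introl erefl).
  by rewrite zeval0 eqxx.
- apply: sound_algebraic2 => T w preT /=.
  by rewrite !evalE; apply: preordering_antisym.
- apply: sound_algebraic1 => T w preT /=.
  rewrite !evalE sqrf_eq0 => /eqP; rewrite subr_eq0 => /eqP xy1.
  split; first exact: preordering_sqr.
  by apply/eqP => x0; move/eqP: xy1; rewrite x0 mul0r eq_sym oner_eq0.
- apply: sound_algebraic2 => T w preT /=.
  by rewrite !evalE sqrf_eq0 => Tx [].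
- move=> T w preT hyps; have [_ /=] := hyps _ (or_introl erefl).
  rewrite !evalE sqrf_eq0 => x_neq0.
  exists (fun=> (w ord0)^-1) => _ [<-|//] /=.
  by rewrite !evalE /= mulfV ?subrr.
- move=> T w preT _ /= fails; set x := w ord0.
  (* If -1 were not in it, adjoin T y would extend T and satisfy A. *)
  have improper y A :
      List.In (atomic_disjunct A)
        [:: atomic_disjunct (Ge0 (zvar ord0));
            atomic_disjunct (Ge0 (- zvar ord0))] ->
      holds (adjoin T y) w A -> ~ ~ adjoin T y (-1).
    move=> inA holdsA propy.
    apply: (fails _ _ (adjoin_preordering preT propy) _ inA).
      by move=> z; apply: adjoin_sub.
    exact/realises_atomic.
  apply: (improper x (Ge0 (zvar ord0))); first by left.
    by rewrite /= evalE; apply: adjoin_gen.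
  move=> improper_x; apply: (improper (- x) (Ge0 (- zvar ord0))).
  - by right; left.
  - by rewrite /= !evalE; apply: adjoin_gen.
  - exact: (adjoin_proper preT improper_x).
- move=> T w preT _ /= fails.
  have [x0 | x_neq0] := eqVneq (w ord0) 0.
    apply: (fails T _ preT) => //; first by left.
    by apply/realises_atomic; rewrite /= evalE.
  apply: (fails T _ preT) => //; first by right; left.
  apply/realises_atomic; rewrite /= !evalE sqrf_eq0.
  by split=> //; apply: preordering_sqr.
Qed.

(** * Coverings *)

Section Coverings.

Variable K : fieldType.

Lemma consequence_holds (Th : theory) (G : choiceType) (R : presentation G)
    (T : K -> Prop) (v : G -> K) :
  (forall a, Th a -> sound K a) -> preordering T ->
  (forall A, R A -> holds T v A) ->
  forall A, consequence Th R A -> holds T v A.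
Proof.
move=> soundTh preT holdsR A; elim=> {A}[A /holdsR //|n H A t ThA _ IH].
apply/(holds_subst T A (fun=> erefl))/realises_atomic.
by apply: (soundTh _ ThA) => // B /IH /(holds_subst T B (fun=> erefl)).
Qed.

Lemma child_holds n (D : disjunct n) (G : choiceType) (R : presentation G)
    (t : 'I_n -> zpoly G) (T : K -> Prop) (v : G -> K) z :
  (forall A, R A -> holds T v A) ->
  (forall A, List.In A (conjuncts D) ->
     holds T (join_val (fun i => zeval v (t i)) z) A) ->
  forall A, child (D := D) R t A -> holds T (join_val v z) A.
Proof.
move=> holdsR holdsD _ [A /holdsR | A /holdsD] holdsA.
  have oldE g :
      zeval (join_val v z) (zvar (inl g : G + 'I_(nbound D))%type) = v g.
    by rewrite evalE.
  exact/(holds_subst T A oldE).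
have newE u : zeval (join_val v z) (child_subst t u) =
    join_val (fun i => zeval v (t i)) z u.
  case: u => [i|j] /=; last by rewrite evalE.
  by rewrite zeval_comp; apply: eq_zeval => g; rewrite evalE.
exact/(holds_subst T A newE).
Qed.

Lemma In_tnth (X : Type) (s : seq X) x :
  List.In x s -> exists i, tnth (in_tuple s) i = x.
Proof.
elim: s => //= y s IH [-> | /IH [i <-]]; first by exists ord0.
by exists (lift ord0 i); rewrite !(tnth_nth x).
Qed.

(** The statement has to range over all preorderings T and valuations v, as both
    are extended when passing to a child.  If all children are dead, then by
    induction every choice of a disjunct in every extension of T is refuted,
    which is what soundness excludes. *)
Lemma no_dead_covering (Th : theory) (G : choiceType) (R : presentation G)
    (c : covering Th R) (T : K -> Prop) (v : G -> K) :
  (forall a, Th a -> sound K a) -> preordering T ->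
  (forall A, R A -> holds T v A) -> ~ all_dead c.
Proof.
move=> soundTh; elim: c T v => [? ? ? ? ? ? ? ? []|].
move=> G' R' l a t consl Tha hyps ch IH T v.
move=> preT holdsR /= dead.
have holdsRl A : add_atoms R' l A -> holds T v A.
  by case=> [/holdsR //|/consl]; apply: consequence_holds.
apply: (sound_refine (w := fun i => zeval v (t i)) (soundTh _ Tha) preT).
  by move=> B /hyps/holdsRl/(holds_subst T B (fun=> erefl)).
move=> T' D preT' TT' inD; have [i <-] := In_tnth inD; case=> z holdsD.
apply: (IH i T' (join_val v z) preT' _ (dead i)).
by apply: child_holds holdsD => A /holdsRl; apply: holds_mono.
Qed.

End Coverings.

Theorem corollary3p5 (K : fieldType) :
  real_field K -> ~ collapses ordered_field_theory (@diagram K).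
Proof.
move=> realK [c]; apply: (no_dead_covering (v := id)).
- exact: ordered_field_sound.
- exact: sum_of_squares_preordering.
- move=> _ [r P a Pa0] /=; rewrite zeval_comp -[RHS]Pa0.
  by apply: eq_zeval => i; rewrite zeval_var.
Qed.
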